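(* The boundaries of the Satake–Baily–Borel compactifications $\overline{\mathcal M}$ of $\mathcal M=\mathcal D/\Gamma$ and $\overline{\mathcal M}^*$ of $\mathcal M^*=\mathcal D/\Gamma^*$ contain two and three zero-dimensional components respectively.
   Context: Let $T=U\oplus U\oplus E_8\oplus A_1^5$ ($U$ the hyperbolic plane, root lattices negative definite), $r_1,\dots,r_5$ an orthogonal basis of the summand $A_1^5$ with $r_i^2=-2$, $\xi_i=r_i/2\in A_T=T^*/T$. Let $\Gamma=O(T)$, $\Gamma^*=\{\gamma\in O(T):\gamma(\xi_1)=\xi_1\}$, $\mathcal D=\{\omega\in\mathbb P(T\otimes\mathbb C):(\omega,\omega)=0,(\omega,\bar\omega)>0\}$. Boundary components of the Satake–Baily–Borel compactification of $\mathcal D/\Gamma$ (resp. $\mathcal D/\Gamma^*$) are in bijection with primitive isotropic sublattices of $T$ up to $\Gamma$ (resp. $\Gamma^*$), rank $k+1$ sublattices corresponding to $k$-dimensional components. *)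

(* Defs.v *)
From HB Require Import structures.
From mathcomp Require Import all_boot all_order all_algebra.
From mathcomp Require Import complex.
From mathcomp Require Import all_classical all_reals.
Set Implicit Arguments.
Unset Strict Implicit.
Unset Printing Implicit Defensive.
Import Order.TTheory GRing.Theory Num.Theory.
Local Open Scope ring_scope.
Local Open Scope classical_set_scope.
Local Open Scope complex_scope.

(* A lattice of rank n is Z^n (row vectors) with an integral symmetric Gram   *)
(* matrix G; matrices act on row vectors from the right.                      *)

Notation toQ := (map_mx (intr : int -> rat)).

Definition osum m n (G : 'M[int]_m) (H : 'M[int]_n) : 'M[int]_(m + n) :=
  block_mx G 0 0 H.

Definition U_lat : 'M[int]_2 := \matrix_(i, j) (i != j)%:R.

(* Bourbaki's labelling of the Dynkin diagram, shifted to start at 0. *)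
Definition E8_edges : seq (nat * nat) :=
  [:: (0, 2); (2, 3); (3, 4); (4, 5); (5, 6); (6, 7); (1, 3)]%N.

Definition E8_lat : 'M[int]_8 := \matrix_(i, j)
  if i == j then - 2
  else (((i : nat, j : nat) \in E8_edges) ||
        ((j : nat, i : nat) \in E8_edges))%:R.

Definition A1_lat (k : nat) : 'M[int]_k := (- 2)%:M.

Definition T_rank : nat := (2 + 2 + 8 + 5)%N.

Definition T_lat : 'M[int]_T_rank :=
  osum (osum (osum U_lat U_lat) E8_lat) (A1_lat 5).

(* r i, for i = 0, ..., 4, is the vector usually written r_(i+1). *)
Definition r (i : 'I_5) : 'rV[int]_T_rank :=
  delta_mx 0 (rshift (2 + 2 + 8) i).

Definition xi (i : 'I_5) : 'rV[rat]_T_rank := 2%:R^-1 *: toQ (r i).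

Definition form (K : pzRingType) n (G : 'M[int]_n) (x y : 'rV[K]_n) : K :=
  (x *m map_mx intr G *m y^T) 0 0.

Definition dual n (G : 'M[int]_n) : set 'rV[rat]_n :=
  [set x | forall y : 'rV[int]_n, form G x (toQ y) \is a Num.int].

Lemma r_form (i j : 'I_5) : form T_lat (r i) (r j) = - 2 *+ (i == j).
Proof.
rewrite /form (_ : map_mx intr T_lat = T_lat); last first.
  by apply/matrixP => a b; rewrite !mxE intz.
rewrite /r -rowE trmx_delta -colE !mxE (unsplitK (inr _)) /= mxE.
by rewrite (unsplitK (inr _)) mxE.
Qed.

Lemma xi_dual (i : 'I_5) : dual T_lat (xi i).
Proof.
move=> y; rewrite /form /xi /r map_delta_mx -!scalemxAl -rowE.
rewrite !mxE; set s := \sum_j _.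
have -> : s = - 2 * (y 0 (rshift (2 + 2 + 8) i))%:~R.
  rewrite /s (bigD1 (rshift (2 + 2 + 8) i)) //= big1 ?addr0.
    by rewrite !mxE (unsplitK (inr _)) /= mxE (unsplitK (inr _)) mxE eqxx.
  move=> j; rewrite !mxE (unsplitK (inr _)) /= mxE.
  case: split_ordP => k ->; rewrite mxE ?mul0r // (inj_eq (@rshift_inj _ _)).
  by rewrite eq_sym => /negPf ->; rewrite mul0r.
by rewrite mulrA mulrN mulVf // mulN1r rpredN intr_int.
Qed.

(* Equality of classes modulo Z^n: for x and y in the dual lattice this is    *)
(* equality in the discriminant group.                                        *)
Definition eq_disc n (x y : 'rV[rat]_n) : Prop :=
  exists t : 'rV[int]_n, x - y = toQ t.

Definition isometries n (G : 'M[int]_n) : set 'M[int]_n :=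
  [set g | g \in unitmx /\ g *m G *m g^T = G].

Definition Gamma : set 'M[int]_T_rank := isometries T_lat.

Definition Gamma_star : set 'M[int]_T_rank :=
  [set g | Gamma g /\ eq_disc (xi ord0 *m toQ g) (xi ord0)].

(* The rows of B form a Z-basis of a primitive isotropic sublattice of rank k. *)
Definition primitive_isotropic n (G : 'M[int]_n) k (B : 'M[int]_(k, n)) : Prop :=
  [/\ row_free (toQ B),
      B *m G *m B^T = 0 &
      forall (m : int) (x : 'rV[int]_n), m != 0 ->
        (exists c : 'rV[int]_k, m *: x = c *m B) ->
        exists c : 'rV[int]_k, x = c *m B].

Section PeriodDomain.
Variables (R : realType) (n : nat) (G : 'M[int]_n).
Local Notation V := ('rV[R[i]]_n).
Local Notation conjv := (map_mx Num.conj).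

(* A point of the projective space is the set of its nonzero representatives. *)
Definition proj_pt (w : V) : set V := [set c *: w | c in [set c | c != 0]].

Definition domain : set (set V) :=
  [set proj_pt w | w in
    [set w : V | [/\ w != 0, form G w w = 0 & 0 < form G w (conjv w)]]].

(* The rational boundary component of the sublattice E spanned by B consists  *)
(* of the [w] such that w and its conjugate span E (x) C. It is the point     *)
(* P(E (x) C) if E has rank 1, and P(E (x) C) minus its real points, i.e. a   *)
(* pair of conjugate half-planes, one for each connected component of the     *)
(* domain, if E has rank 2.                                                   *)
Definition rat_bcomp k (B : 'M[int]_(k, n)) : set (set V) :=
  [set proj_pt w | w in
    [set w : V | (col_mx w (conjv w) == map_mx intr B)%MS]].

Definition extended_domain : set (set V) :=
  domain `|`
  [set p | exists k (B : 'M[int]_(k.+1, n)),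
             primitive_isotropic G B /\ rat_bcomp B p].

Definition act_pt (g : 'M[int]_n) (p : set V) : set V :=
  [set w *m map_mx intr g | w in p].

(* The point of the quotient by H defined by p, i.e. its orbit. *)
Definition quot_pt (H : set 'M[int]_n) (p : set V) : set (set V) :=
  [set act_pt g p | g in H].

(* The underlying set of the Satake-Baily-Borel compactification of the       *)
(* quotient of the domain by H.                                               *)
Definition SBB (H : set 'M[int]_n) : set (set (set V)) :=
  quot_pt H @` extended_domain.

Definition SBB_boundary (H : set 'M[int]_n) : set (set (set V)) :=
  SBB H `\` (quot_pt H @` domain).

(* The boundary components of dimension k, as subsets of the boundary: the    *)
(* sublattice E has rank k + 1, and the component is the image of P(E (x) C)  *)
(* minus its real points.                                                     *)
Definition boundary_components (H : set 'M[int]_n) (k : nat) :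
    set (set (set (set V))) :=
  [set X | X `<=` SBB_boundary H /\
     exists2 B : 'M[int]_(k.+1, n),
       primitive_isotropic G B & X = quot_pt H @` rat_bcomp B].

End PeriodDomain.

Arguments boundary_components R {n} G H k.

(* Main.v *)
From HB Require Import structures.
From mathcomp Require Import all_boot all_order all_algebra.
From mathcomp Require Import complex.
From mathcomp Require Import all_classical all_reals.
From mathcomp Require Import ring zify.
Require Import Defs.
Set Implicit Arguments.
Unset Strict Implicit.
Unset Printing Implicit Defensive.
Import Order.TTheory GRing.Theory Num.Theory.
Local Open Scope ring_scope.
Local Open Scope classical_set_scope.
Local Open Scope card_scope.
Local Open Scope complex_scope.

(** A zero-dimensional boundary component is the orbit of the point [v] for a
    primitive isotropic vector v of T, and two such vectors v, w give the same
    component exactly when w = v g or w = - v g for some g in the group: a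
    complex proportionality factor between primitive integral vectors is an
    integer, and so is its inverse ([cusp_equiv]). It remains to count the
    orbits of primitive isotropic vectors up to sign.

    Let the divisor of v be the positive generator m of the ideal (v, T), so
    that v/m represents an isotropic class of the discriminant group A_T. Since
    T contains two orthogonal hyperbolic planes, Eichler's criterion says that
    (m, v/m mod T) determines the orbit of v under the isometries acting
    trivially on A_T. Here it is proved with the transvections t(e, x)
    ([eichler]), all of which lie in the smaller group, in two steps.
    - A vector of the orbit of v whose pairing with a fixed isotropic e is
      positive and as small as possible has its divisor equal to this pairing:
      otherwise the second hyperbolic plane gives a smaller positive pairing, as
      in the Euclidean algorithm ([orbit_divisor]).
    - If v and w are isotropic, (v, e) = (w, e) = m and w - v = m x, then the
      transvection t(e, x) maps v to w ([eichler_criterion]).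

    Since 2 A_T = 0, the divisor is 1 or 2. Divisor 1 gives a single orbit, that
    of the basis vector [U1_vec 1]. For divisor 2, v is congruent modulo 2 T to
    a sum of some of the r_i, and (v, v) = 0 forces the number of terms to be
    divisible by 4; it is not 0 since v is primitive, so all r_i but one, say
    r_j, occur, and v is equivalent to the model vector [div2_vec j].
    Isometries exchanging two of the r_i permute these five vectors; the ones
    that fix r_0 leave the two classes j = 0 and j <> 0, and with the others
    only one class is left ([Gamma_star_orbits3], [Gamma_orbits2]).

    The orbits that remain are distinct: the parity of the divisor is an
    invariant of the full group, and for a vector v of even divisor, (v, r_0)
    modulo 4 is an invariant of the stabiliser of xi_0, because (v / 2, xi_0)
    modulo 1 is the value of the discriminant form. *)

(** * Isometries and Eichler transvections *)

Section Form.
Variables (K : comPzRingType) (n : nat) (G : 'M[int]_n).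
Implicit Types (x y : 'rV[K]_n) (c : K).

Lemma formDl x x' y : form G (x + x') y = form G x y + form G x' y.
Proof. by rewrite /form !mulmxDl mxE. Qed.

Lemma formDr x y y' : form G x (y + y') = form G x y + form G x y'.
Proof. by rewrite /form linearD mulmxDr mxE. Qed.

Lemma formZl c x y : form G (c *: x) y = c * form G x y.
Proof. by rewrite /form -!scalemxAl mxE. Qed.

Lemma formZr c x y : form G x (c *: y) = c * form G x y.
Proof. by rewrite /form linearZ -scalemxAr mxE. Qed.

Lemma formNl x y : form G (- x) y = - form G x y.
Proof. by rewrite -scaleN1r formZl mulN1r. Qed.

Lemma formNr x y : form G x (- y) = - form G x y.
Proof. by rewrite -scaleN1r formZr mulN1r. Qed.

Lemma formC : G^T = G -> forall x y, form G x y = form G y x.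
Proof.
move=> GT x y; rewrite /form.
have -> : x *m map_mx intr G *m y^T = (y *m map_mx intr G *m x^T)^T.
  by rewrite !trmx_mul trmxK map_trmx GT mulmxA.
by rewrite mxE.
Qed.

Lemma form_isometry g x y : isometries G g ->
  form G (x *m map_mx intr g) (y *m map_mx intr g) = form G x y.
Proof.
case=> _ gG; rewrite /form trmx_mul !mulmxA -(mulmxA x) -map_mxM.
by rewrite -(mulmxA x) map_trmx -map_mxM gG.
Qed.

End Form.

Lemma map_intz m n (A : 'M[int]_(m, n)) : map_mx intr A = A.
Proof. by apply/matrixP => i j; rewrite mxE intz. Qed.

Lemma intr_mx_inj (F : numDomainType) m n :
  injective (map_mx intr : 'M[int]_(m, n) -> 'M[F]_(m, n)).
Proof.
move=> A B /matrixP AB; apply/matrixP => i j.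
by have := AB i j; rewrite !mxE => /intr_inj.
Qed.

Section IntForm.
Variables (n : nat) (G : 'M[int]_n).
Implicit Types (x y v w e f : 'rV[int]_n) (g : 'M[int]_n).

Lemma formE x y : form G x y = (x *m G *m y^T) 0 0.
Proof. by rewrite /form map_intz. Qed.

Lemma form_mx x y : x *m G *m y^T = (form G x y)%:M.
Proof. by rewrite formE -mx11_scalar. Qed.

Lemma form_delta i j : form G (delta_mx 0 i) (delta_mx 0 j) = G i j.
Proof. by rewrite formE -rowE trmx_delta -colE 2!mxE. Qed.

Lemma form_delta_r x j : form G x (delta_mx 0 j) = (x *m G) 0 j.
Proof. by rewrite formE trmx_delta -colE mxE. Qed.

Lemma isometry_form g x y : isometries G g ->
  form G (x *m g) (y *m g) = form G x y.
Proof. by move=> gG; rewrite -{1 2}[g]map_intz form_isometry. Qed.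

(** Comparing determinants in g G g^T = G gives (det g)^2 = 1, so invertibility
    over the integers comes for free. *)
Lemma form_isometries g : \det G != 0 ->
  (forall x y, form G (x *m g) (y *m g) = form G x y) -> isometries G g.
Proof.
move=> G0 gG; have e: g *m G *m g^T = G.
  apply/matrixP => i j; rewrite -[RHS]form_delta -gG formE.
  by rewrite trmx_mul !mulmxA -rowE trmx_delta -colE -!row_mul !mxE.
split=> //; move: (congr1 determinant e); rewrite !det_mulmx det_tr.
move=> e2; have : \det g * \det g = 1.
  by apply: (mulIf G0); rewrite mul1r -[RHS]e2; ring.
by rewrite unitmxE => e3; apply/unitrPr; exists (\det g).
Qed.

(** Splitting G as L + L^T, with the halves of the diagonal in the triangular
    matrix L, shows that the quadratic form takes even values. *)
Lemma even_form x : G^T = G -> (forall i, (2 %| G i i)%Z) ->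
  exists q : int, form G x x = 2 * q.
Proof.
move=> GT G2.
pose L : 'M[int]_n := \matrix_(i, j)
  if (i < j)%N then G i j else if i == j then (G i i %/ 2)%Z else 0.
have GL : G = L + L^T.
  apply/matrixP => i j; rewrite !mxE (eq_sym j i) -val_eqE /=.
  have GE: G j i = G i j by rewrite -[in RHS]GT mxE.
  case: ltngtP => [|| ij]; rewrite ?addr0 ?add0r ?GE //.
  have -> : j = i by apply/val_inj.
  by have := G2 i => /divzK; lia.
exists ((x *m L *m x^T) 0 0); rewrite formE GL mulmxDr mulmxDl mxE.
have -> : x *m L^T *m x^T = (x *m L *m x^T)^T by rewrite !trmx_mul trmxK mulmxA.
by rewrite [X in _ + X]mxE; ring.
Qed.

(** The transvection t(e, x) sending v to
    v - (v, x) e + (v, e) x - q (v, e) e; it is an isometry when e is isotropic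
    and orthogonal to x, and (x, x) = 2 q. *)
Definition eichler e x (q : int) : 'M[int]_n :=
  1%:M + G *m (e^T *m (x - q *: e) - x^T *m e).

Lemma mul_eichler v e x q : v *m eichler e x q =
  v - form G v x *: e + form G v e *: x - (q * form G v e) *: e.
Proof.
rewrite /eichler mulmxDr mulmx1 mulmxA mulmxBr !mulmxA !form_mx.
by rewrite !mul_scalar_mx scalerBr scalerA (mulrC q) addrA addrAC addrA.
Qed.

Lemma eichler_isometry e x q : \det G != 0 -> G^T = G ->
  form G e e = 0 -> form G e x = 0 -> form G x x = 2 * q ->
  isometries G (eichler e x q).
Proof.
move=> G0 GT ee ex xx; apply: form_isometries => // v w.
rewrite !mul_eichler !(formDl, formDr, formZl, formZr, formNl, formNr).
by rewrite (formC GT x e) ee ex xx (formC GT e w) (formC GT x w); ring.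
Qed.

End IntForm.

(** * Eichler's criterion *)

Section Descent.
Variables (n : nat) (G : 'M[int]_n) (H : set 'M[int]_n).
Hypotheses (GT : G^T = G) (G0 : \det G != 0).
Hypothesis Geven : forall i, (2 %| G i i)%Z.
Hypotheses (H1 : H 1%:M) (HN : H (- 1%:M)).
Hypothesis HM : forall g h, H g -> H h -> H (g *m h).
Hypothesis H_eichler : forall e x (q : int), form G e e = 0 -> form G e x = 0 ->
  form G x x = 2 * q -> H (eichler G e x q).
Implicit Types (e f x v w : 'rV[int]_n).

Local Notation "<( v , w )>" := (form G v w) (format "<( v ,  w )>").
Let fC := @formC int _ _ GT.
Let fE := (@formDl int _ G, @formDr int _ G, @formZl int _ G, @formZr int _ G,
  @formNl int _ G, @formNr int _ G).

Definition orbit_rel v w := exists2 g, H g & w = v *m g.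

Lemma orbit_rel_refl v : orbit_rel v v.
Proof. by exists 1%:M; rewrite ?mulmx1. Qed.

Lemma orbit_rel_trans v w u : orbit_rel v w -> orbit_rel w u -> orbit_rel v u.
Proof.
by move=> [g gH ->] [h hH ->]; exists (g *m h); rewrite ?mulmxA //; exact: HM.
Qed.

Lemma orbit_relN v : orbit_rel v (- v).
Proof. by exists (- 1%:M); rewrite // mulmxN mulmx1. Qed.

Lemma orbit_eichler v e x q : <(e, e)> = 0 -> <(e, x)> = 0 ->
  <(x, x)> = 2 * q ->
  orbit_rel v (v - <(v, x)> *: e + <(v, e)> *: x - (q * <(v, e)>) *: e).
Proof.
by move=> ee ex xx; exists (eichler G e x q); rewrite ?mul_eichler //;
  exact: H_eichler.
Qed.

Lemma orbit_eichler0 v e x : <(e, e)> = 0 -> <(e, x)> = 0 -> <(x, x)> = 0 ->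
  orbit_rel v (v - <(v, x)> *: e + <(v, e)> *: x).
Proof.
move=> ee ex xx; have := @orbit_eichler v e x 0 ee ex.
by rewrite xx mulr0 mul0r scale0r subr0; apply.
Qed.

(** The vector x is orthogonal to e because v and w pair equally with e, and
    (v, v) = (w, w) determines its norm: (v, x) = - m q when (x, x) = 2 q. The
    two multiples of e in the formula for t(e, x) then cancel, so that t(e, x)
    adds exactly m x to v. *)
Lemma eichler_criterion v w e x (m : int) : m != 0 ->
  <(e, e)> = 0 -> <(v, e)> = m -> <(w, e)> = m ->
  <(v, v)> = 0 -> <(w, w)> = 0 -> w = v + m *: x -> orbit_rel v w.
Proof.
move=> m0 ee ve we vv ww wE.
have ex : <(e, x)> = 0.
  apply: (mulfI m0); rewrite mulr0 -formZr.
  have -> : m *: x = w - v by rewrite wE addrC addKr.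
  by rewrite !fE fC we fC ve subrr.
have [q xx] := even_form x GT Geven.
have vx : <(v, x)> = - (m * q).
  have : m * (2 * (<(v, x)> + m * q)) = 0.
    by rewrite -ww wE !fE vv (fC x v) xx; ring.
  by move/eqP; rewrite !mulf_eq0 (negPf m0) /= addr_eq0 => /eqP.
have := orbit_eichler v ee ex xx; rewrite ve vx.
suff -> : v - - (m * q) *: e + m *: x - (q * m) *: e = w by [].
by rewrite wE scaleNr opprK (mulrC q) addrAC addrK.
Qed.

Definition hyperbolic_pair e f :=
  [/\ <(e, e)> = 0, <(f, f)> = 0 & <(e, f)> = 1].

Definition orthogonal_pairs e f e' f' :=
  [/\ <(e, e')> = 0, <(e, f')> = 0, <(f, e')> = 0 & <(f, f')> = 0].

Lemma form_nondegenerate v : v != 0 -> exists x, <(v, x)> != 0.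
Proof.
move=> v0; apply: contrapT => no.
have : v *m G = 0.
  apply/rowP => j; rewrite [RHS]mxE -form_delta_r; apply/eqP.
  by apply: contrapT => /negP h; apply: no; exists (delta_mx 0 j).
move=> /(congr1 (mulmxr (\adj G))) /=; rewrite mul0mx -mulmxA mul_mx_adj.
rewrite mul_mx_scalar => /eqP; rewrite scalemx_eq0.
by rewrite (negPf G0) (negPf v0).
Qed.

(** If every vector of the orbit were orthogonal to e, the transvections
    t(f, x) would make v orthogonal to the second hyperbolic plane, then to f,
    and finally to the whole lattice. *)
Lemma orbit_pairing_neq0 v e f e' f' : v != 0 ->
  hyperbolic_pair e f -> hyperbolic_pair e' f' -> orthogonal_pairs e f e' f' ->
  exists2 w, orbit_rel v w & <(w, e)> != 0.
Proof.
move=> v0 [ee ff ef] [ee' ff' ef'] [hee' hef' hfe' hff'].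
apply: contrapT => no.
have zero w : orbit_rel v w -> <(w, e)> = 0.
  by move=> vw; apply/eqP; apply: contrapT => /negP we; apply: no; exists w.
have ve := zero v (orbit_rel_refl v).
(* The pairing of e with the image of v under t(f, x) vanishes too. *)
have move_f x q : <(f, x)> = 0 -> <(x, e)> = 0 -> <(x, x)> = 2 * q ->
    <(v, x)> = - (q * <(v, f)>).
  move=> fx xe xx; have := zero _ (orbit_eichler v ff fx xx).
  by rewrite !fE ve xe (fC f e) ef; lia.
have ve' : <(v, e')> = 0.
  by rewrite (move_f e' 0) ?mul0r ?oppr0 ?mulr0 // fC.
have vf' : <(v, f')> = 0.
  by rewrite (move_f f' 0) ?mul0r ?oppr0 ?mulr0 // fC.
have vf : <(v, f)> = 0.
  have := move_f (e' + f') 1.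
  rewrite !fE hfe' hff' (fC _ e) hee' (fC _ e) hef'.
  rewrite ee' ff' (fC f' e') ef' ve' vf'.
  by move=> /(_ erefl erefl erefl); lia.
have [x] := form_nondegenerate v0; case/negP; apply/eqP.
pose y := x - <(f, x)> *: e - <(e, x)> *: f.
have -> : <(v, x)> = <(v, y)> by rewrite /y !fE ve vf; ring.
have [q yy] := even_form y GT Geven.
rewrite (move_f y q) ?vf ?mulr0 ?oppr0 //.
  by rewrite /y !fE (fC f e) ef ff; ring.
by rewrite /y !fE (fC x e) (fC f e) ef ee; ring.
Qed.

(** A Euclidean division step. The transvection t(e, k e') adds k m to the
    pairing with f', so it may be replaced by its remainder modulo m; were the
    remainder rho positive, t(f, f') would lower the pairing with e to m - rho,
    contradicting the minimality of m. *)
Lemma orbit_clear_pairing v0 v e f e' f' (m : int) :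
  hyperbolic_pair e f -> hyperbolic_pair e' f' -> orthogonal_pairs e f e' f' ->
  (forall w, orbit_rel v0 w -> 0 < <(w, e)> -> m <= <(w, e)>) -> 0 < m ->
  orbit_rel v0 v -> <(v, e)> = m ->
  [/\ (m %| <(v, f')>)%Z &
    exists w, [/\ orbit_rel v0 w, <(w, e)> = m, <(w, e')> = <(v, e')> &
                  <(w, f')> = 0]].
Proof.
move=> [ee ff ef] [ee' ff' ef'] [hee' hef' hfe' hff'] min m0 v0v ve.
pose k := - (<(v, f')> %/ m)%Z.
have v0w : orbit_rel v0 (v - <(v, k *: e')> *: e + <(v, e)> *: (k *: e')).
  apply: orbit_rel_trans v0v _; apply: orbit_eichler0 => //.
    by rewrite fE hee' mulr0.
  by rewrite !fE ee' !mulr0.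
set w := (X in orbit_rel v0 X) in v0w.
have we : <(w, e)> = m.
  by rewrite /w !fE ee (fC e' e) hee' ve !mulr0 oppr0 !addr0.
have we' : <(w, e')> = <(v, e')>.
  by rewrite /w !fE hee' ee' !mulr0 oppr0 !addr0.
have wf' : <(w, f')> = (<(v, f')> %% m)%Z.
  by rewrite /w !fE hef' ef' ve /modz /k; ring.
have v0u : orbit_rel v0 (w - <(w, f')> *: f + <(w, f)> *: f').
  by apply: orbit_rel_trans v0w _; exact: orbit_eichler0.
clearbody w; have := min _ v0u.
rewrite !fE we (fC f e) ef (fC f' e) hef' wf' mulr0 addr0 mulr1 => {}min.
have r0 : 0 <= (<(v, f')> %% m)%Z by apply: modz_ge0; rewrite gt_eqF.
have rm : (<(v, f')> %% m)%Z < m by apply: ltz_pmod.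
have r00 : (<(v, f')> %% m)%Z = 0.
  by apply/eqP; apply: contrapT => /eqP/eqP r0'; lia.
split; first exact/dvdz_mod0P.
by exists w; rewrite wf'.
Qed.

(** A minimal vector u is first made orthogonal to the second hyperbolic plane.
    For y orthogonal to e', the transvection t(e', y) then only adds
    - (u, y) e' to u, so the division step, applied to the pairing - (u, y)
    with f', gives m %| (u, y). Every vector differs from such a y by a multiple
    of f', to which u is orthogonal. *)
Lemma orbit_divisor v e f e' f' : v != 0 ->
  hyperbolic_pair e f -> hyperbolic_pair e' f' -> orthogonal_pairs e f e' f' ->
  exists w (m : int), [/\ orbit_rel v w, 0 < m, <(w, e)> = m &
    forall x, (m %| <(w, x)>)%Z].
Proof.
move=> v0 hef hef' ort.
pose P k := `[< exists w, orbit_rel v w /\ <(w, e)> = k.+1%:Z >].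
have exP : exists k, P k.
  have [w vw we] := orbit_pairing_neq0 v0 hef hef' ort.
  exists `|<(w, e)>|.-1; apply/asboolP.
  case: (ltrP 0 <(w, e)>) => h; first by exists w; split=> //; lia.
  exists (- w); split; first exact: orbit_rel_trans vw (orbit_relN _).
  move: h; rewrite fE le_eqVlt (negPf we) /=; set t := form _ _ _; clearbody t.
by lia.
case: (ex_minnP exP) => k /asboolP[w [vw we]] kmin.
set m := k.+1%:Z in we; have m0 : 0 < m by [].
have min u : orbit_rel v u -> 0 < <(u, e)> -> m <= <(u, e)>.
  move=> vu u0; have : (k <= `|<(u, e)>|.-1)%N.
    by apply: kmin; apply/asboolP; exists u; split=> //; lia.
  by rewrite /m; lia.
have [_ [w1 [vw1 w1e _ w1f']]] :=
  orbit_clear_pairing hef hef' ort min m0 vw we.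
have [[ee' ff' ef'] [hee' hef'0 hfe' hff']] := (hef', ort).
have hfe : hyperbolic_pair f' e' by split; rewrite // fC.
have ort' : orthogonal_pairs e f f' e' by [].
have [_ [u [vu ue]]] := orbit_clear_pairing hef hfe ort' min m0 vw1 w1e.
rewrite w1f' => uf' ue'.
exists u, m; split=> // x.
pose y := x - <(e', x)> *: f'.
have -> : <(u, x)> = <(u, y)> by rewrite !fE uf' mulr0 oppr0 addr0.
have [q yy] := even_form y GT Geven.
have e'y : <(e', y)> = 0 by rewrite !fE ef' mulr1 subrr.
have vz := orbit_rel_trans vu (orbit_eichler u ee' e'y yy).
have := orbit_clear_pairing hef hef' ort min m0 vz.
rewrite !fE ue' uf' ue (fC e' e) hee' ef' => -[]; first by ring.
by rewrite !(mulr0, mul0r, oppr0, addr0, add0r, mulr1) dvdzE abszN -dvdzE.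
Qed.

End Descent.

(** * The lattice T *)

Lemma osum_tr m n (G : 'M[int]_m) (H : 'M[int]_n) :
  G^T = G -> H^T = H -> (osum G H)^T = osum G H.
Proof. by move=> gt ht; rewrite /osum tr_block_mx !trmx0 gt ht. Qed.

Lemma osum_mul m n (G G' : 'M[int]_m) (H H' : 'M[int]_n) :
  osum G H *m osum G' H' = osum (G *m G') (H *m H').
Proof. by rewrite /osum mulmx_block !mulmx0 !mul0mx !addr0 !add0r. Qed.

Lemma osum_diag m n (G : 'M[int]_m) (H : 'M[int]_n) :
  (forall i, (2 %| G i i)%Z) -> (forall i, (2 %| H i i)%Z) ->
  forall i, (2 %| osum G H i i)%Z.
Proof.
move=> g2 h2 i; case: (split_ordP i) => j ->;
by rewrite /osum ?block_mxEul ?block_mxEdr.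
Qed.

Lemma U_lat_tr : U_lat^T = U_lat.
Proof. by apply/matrixP => i j; rewrite !mxE eq_sym. Qed.

Lemma E8_lat_tr : E8_lat^T = E8_lat.
Proof. by apply/matrixP => i j; rewrite !mxE eq_sym orbC. Qed.

Lemma T_lat_tr : T_lat^T = T_lat.
Proof.
by rewrite !osum_tr ?U_lat_tr ?E8_lat_tr // /A1_lat tr_scalar_mx.
Qed.

Lemma T_lat_even i : (2 %| T_lat i i)%Z.
Proof.
by move: i; do !apply: osum_diag; move=> i; rewrite mxE eqxx.
Qed.

(** The inverse Cartan matrix of E_8. *)
Definition E8_inv_coefs : seq (seq nat) :=
  [:: [:: 4; 5; 7; 10; 8; 6; 4; 2];
      [:: 5; 8; 10; 15; 12; 9; 6; 3];
      [:: 7; 10; 14; 20; 16; 12; 8; 4];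
      [:: 10; 15; 20; 30; 24; 18; 12; 6];
      [:: 8; 12; 16; 24; 20; 15; 10; 5];
      [:: 6; 9; 12; 18; 15; 12; 8; 4];
      [:: 4; 6; 8; 12; 10; 8; 6; 3];
      [:: 2; 3; 4; 6; 5; 4; 3; 2]]%N.

Definition E8_inv : 'M[int]_8 :=
  \matrix_(i, j) - (nth 0%N (nth [::] E8_inv_coefs i) j)%:Z.

Lemma E8_latK : E8_lat *m E8_inv = 1%:M.
Proof.
apply/matrixP => i j; rewrite !mxE.
under eq_bigr do rewrite !mxE -val_eqE /=.
rewrite -val_eqE /=.
(* The same sum over natural numbers, in which the 64 entries can be
   evaluated. *)
pose F (i j : nat) : int := \sum_(0 <= k < 8)
  (if (i == k)%N then -2
   else (((i, k) \in E8_edges) || ((k, i) \in E8_edges))%:R) *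
  - (nth 0%N (nth [::] E8_inv_coefs k) j)%:Z.
transitivity (F i j).
  by rewrite /F big_mkord.
have : all (fun i => all (fun j => F i j == (i == j)%:R) (iota 0 8)) (iota 0 8).
  by rewrite /F unlock; vm_compute.
move=> /allP/(_ i); rewrite mem_iota ltn_ord => /(_ isT)/allP/(_ j).
by rewrite mem_iota ltn_ord => /(_ isT)/eqP.
Qed.

Lemma U_latK : U_lat *m U_lat = 1%:M.
Proof.
apply/matrixP => i j; rewrite !mxE !big_ord_recl big_ord0 !mxE.
by case: i j => [[|[|//]] ?] [[|[|//]] ?].
Qed.

(** Twice the inverse of the Gram matrix: its integrality says that the
    discriminant group of T is killed by 2. *)
Definition T_inv2 : 'M[int]_T_rank :=
  osum (osum (osum (2 *: U_lat) (2 *: U_lat)) (2 *: E8_inv)) (-1)%:M.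

Lemma T_latK : T_lat *m T_inv2 = 2%:M.
Proof.
rewrite /T_lat /T_inv2 !osum_mul -!scalemxAr U_latK E8_latK /A1_lat.
rewrite -scalar_mxM !scalemx1 /osum.
by rewrite -!scalar_mx_block.
Qed.

Lemma T_lat_det : \det T_lat != 0.
Proof.
apply/eqP => d0; have /eqP := congr1 determinant T_latK.
by rewrite det_mulmx d0 mul0r det_scalar eq_sym expf_eq0.
Qed.

Lemma dvd_scale n (d : int) (x : 'rV[int]_n) :
  (forall j, (d %| x 0%R j)%Z) -> exists y, x = d *: y.
Proof.
move=> dx; exists (\row_j (x 0%R j %/ d)%Z); apply/rowP => j.
by rewrite !mxE mulrC divzK.
Qed.

(** * Primitive isotropic vectors *)

Section Primitive.
Variables (n : nat) (G : 'M[int]_n).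

Lemma primitive_isotropic1P (B : 'rV[int]_n) : primitive_isotropic G B <->
  [/\ B != 0, form G B B = 0 &
      forall (m c : int) x, m != 0 -> m *: x = c *: B -> exists d, x = d *: B].
Proof.
have rfE : row_free (toQ B) = (B != 0).
  rewrite /row_free rank_rV -(inj_eq (@intr_mx_inj rat _ _)) map_mx0.
  by rewrite eqb1.
split=> -[h1 h2 h3]; split.
- by rewrite -rfE.
- by rewrite formE h2 mxE.
- move=> m c x m0 mx; have [|d ->] := h3 m x m0.
    by exists c%:M; rewrite mul_scalar_mx.
  by exists (d 0 0); rewrite [d in LHS]mx11_scalar mul_scalar_mx.
- by rewrite rfE.
- by rewrite form_mx h2 raddf0.
- move=> m x m0 [c mx]; have [|d ->] := h3 m (c 0 0) x m0.
    by rewrite mx [c in LHS]mx11_scalar mul_scalar_mx.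
  by exists d%:M; rewrite mul_scalar_mx.
Qed.

Lemma primitive_isotropic_unit (B : 'rV[int]_n) k :
  form G B B = 0 -> B 0 k = 1 -> primitive_isotropic G B.
Proof.
move=> BB Bk; apply/primitive_isotropic1P; split=> //.
  by apply/eqP => B0; move: Bk; rewrite B0 mxE.
move=> m c x m0 mx; exists (x 0 k).
have := congr1 (fun y : 'rV_n => y 0 k) mx; rewrite !mxE Bk mulr1 => cE.
apply/rowP => j; apply: (mulfI m0).
have := congr1 (fun y : 'rV_n => y 0 j) mx; rewrite !mxE => ->.
by rewrite -cE mulrA.
Qed.

Lemma primitive_isotropic_act (B : 'rV[int]_n) g : isometries G g ->
  primitive_isotropic G B -> primitive_isotropic G (B *m g).
Proof.
move=> gG; have [gu _] := gG.
move=> /primitive_isotropic1P[B0 BB Bsat]; apply/primitive_isotropic1P; split.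
- by apply: contra_neq B0 => Bg; rewrite -(mulmxK gu B) Bg mul0mx.
- by rewrite isometry_form.
- move=> m c x m0 mx; have [|d xE] := Bsat m c (x *m invmx g) m0.
    by rewrite scalemxAl mx -scalemxAl mulmxK.
  by exists d; rewrite -(mulmxKV gu x) xE scalemxAl.
Qed.

End Primitive.

Lemma dvd_form_mx n (G : 'M[int]_n) (d : int) (v : 'rV[int]_n) :
  (forall x, (d %| form G v x)%Z) -> exists c, v *m G = d *: c.
Proof.
by move=> dv; apply: dvd_scale => j; rewrite -form_delta_r; exact: dv.
Qed.

(** If v G = d c then 2 v = d (c T_inv2), so c T_inv2 is an integral multiple of
    the primitive vector v, and d divides 2. *)
Lemma divisor_eq1_or_2 (v : 'rV[int]_T_rank) (d : int) :
  primitive_isotropic T_lat v -> 0 < d ->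
  (forall x, (d %| form T_lat v x)%Z) -> d = 1 \/ d = 2.
Proof.
move=> /primitive_isotropic1P[v0 _ vsat] d0 /dvd_form_mx[c vT].
have dc : d *: (c *m T_inv2) = 2 *: v.
  by rewrite scalemxAl -vT -mulmxA T_latK mul_mx_scalar.
have [|k ck] := vsat d 2 (c *m T_inv2) _ dc; first by rewrite gt_eqF.
move: dc; rewrite ck scalerA => /eqP; rewrite -subr_eq0 -scalerBl.
rewrite scalemx_eq0 (negPf v0) orbF => /eqP/subr0_eq dk.
have /dvdn_leq : (d %| 2)%Z by apply/dvdzP; exists k; rewrite mulrC dk.
by lia.
Qed.

(** * Vectors of T *)

Definition U1_vec (i : 'I_2) : 'rV[int]_T_rank :=
  delta_mx 0 (lshift 5 (lshift 8 (lshift 2 i))).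
Definition U2_vec (i : 'I_2) : 'rV[int]_T_rank :=
  delta_mx 0 (lshift 5 (lshift 8 (rshift 2 i))).
Definition A1_vec (z : 'rV[int]_5) : 'rV[int]_T_rank :=
  row_mx (0 : 'rV_(2 + 2 + 8)) z.

Lemma A1_vecl z i : A1_vec z 0 (lshift 5 i) = 0.
Proof. by rewrite /A1_vec (@row_mxEl _ 1 (2 + 2 + 8) 5) mxE. Qed.

Lemma A1_vecr z i : A1_vec z 0 (rshift (2 + 2 + 8) i) = z 0 i.
Proof. by rewrite /A1_vec (@row_mxEr _ 1 (2 + 2 + 8) 5). Qed.

Lemma r_A1 i : r i = A1_vec (delta_mx 0 i).
Proof.
apply/rowP => k; rewrite /r mxE; case: (split_ordP k) => j ->.
  by rewrite A1_vecl eq_lrshift.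
by rewrite A1_vecr mxE (inj_eq (@rshift_inj _ _)).
Qed.

(** This eigenvector property makes every vector of A_1^5 pair evenly with T. *)
Lemma A1_vec_T z : A1_vec z *m T_lat = -2 *: A1_vec z.
Proof.
rewrite /A1_vec /T_lat {1}/osum.
rewrite (@mul_row_block _ 1 (2 + 2 + 8) 5 (2 + 2 + 8) 5).
by rewrite !mul0mx mulmx0 !add0r mul_mx_scalar scale_row_mx scaler0.
Qed.

Lemma form_A1 z y : form T_lat (A1_vec z) y = -2 * (A1_vec z *m y^T) 0 0.
Proof. by rewrite formE A1_vec_T -scalemxAl mxE. Qed.

Lemma form_A1_A1 z z' :
  form T_lat (A1_vec z) (A1_vec z') = -2 * (z *m z'^T) 0 0.
Proof.
rewrite form_A1 /A1_vec (@tr_row_mx _ 1 (2 + 2 + 8) 5).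
rewrite (@mul_row_col _ 1 (2 + 2 + 8) 5 1).
by rewrite mul0mx add0r.
Qed.

Lemma form_U1 i j : form T_lat (U1_vec i) (U1_vec j) = U_lat i j.
Proof. by rewrite form_delta /T_lat /osum !block_mxEul. Qed.

Lemma form_U2 i j : form T_lat (U2_vec i) (U2_vec j) = U_lat i j.
Proof. by rewrite form_delta /T_lat /osum 2!block_mxEul block_mxEdr. Qed.

Lemma form_U1_U2 i j : form T_lat (U1_vec i) (U2_vec j) = 0.
Proof. by rewrite form_delta /T_lat /osum 2!block_mxEul block_mxEur mxE. Qed.

Lemma form_A1_U1 z i : form T_lat (A1_vec z) (U1_vec i) = 0.
Proof. by rewrite form_delta_r A1_vec_T mxE A1_vecl mulr0. Qed.

Lemma U1_hyperbolic : hyperbolic_pair T_lat (U1_vec 0) (U1_vec 1).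
Proof. by split; rewrite form_U1 mxE. Qed.

Lemma U2_hyperbolic : hyperbolic_pair T_lat (U2_vec 0) (U2_vec 1).
Proof. by split; rewrite form_U2 mxE. Qed.

Lemma U1_U2_orthogonal :
  orthogonal_pairs T_lat (U1_vec 0) (U1_vec 1) (U2_vec 0) (U2_vec 1).
Proof. by split; rewrite form_U1_U2. Qed.

Lemma even_T_lat v : exists q : int, form T_lat v v = 2 * q.
Proof. exact: even_form T_lat_tr T_lat_even. Qed.

Definition ones (s : pred 'I_5) : 'rV[int]_5 := \row_i (s i)%:R.

Lemma ones_sqr s : (ones s *m (ones s)^T) 0 0 = #|s|%:R.
Proof.
rewrite mxE -sum1_card natr_sum [RHS]big_mkcond; apply: eq_bigr => i _.
by rewrite !mxE -natrM mulnb andbb unfold_in; case: (s i).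
Qed.

(** U and E_8 are unimodular, so the coordinates of v on them are even; only
    those on A_1^5 survive modulo 2. *)
Lemma even_divisor_mod2 (v : 'rV[int]_T_rank) :
  (forall x, (2 %| form T_lat v x)%Z) ->
  exists (s : pred 'I_5) y, v = 2 *: y + A1_vec (ones s).
Proof.
move=> /dvd_form_mx[c vT].
have vE : v = c *m T_inv2.
  apply/rowP => j; apply: (@mulfI _ 2) => //.
  have := congr1 (fun M => (M *m T_inv2) 0 j) vT.
  by rewrite /= -mulmxA T_latK mul_mx_scalar -scalemxAl mxE => ->; rewrite mxE.
pose cl : 'rV[int]_(2 + 2 + 8) := @lsubmx _ 1 (2 + 2 + 8) 5 c.
pose z : 'rV[int]_5 := - @rsubmx _ 1 (2 + 2 + 8) 5 c.
pose D : 'M[int]_(2 + 2 + 8) := osum (osum U_lat U_lat) E8_inv.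
have DE : T_inv2 = osum (2 *: D) (-1)%:M.
  by rewrite /T_inv2 /D /osum !scale_block_mx !scaler0.
exists (fun i => (z 0%R i %% 2)%Z != 0).
exists (row_mx (cl *m D) (\row_i (z 0%R i %/ 2)%Z)).
rewrite vE DE -[c](@hsubmxK _ 1 (2 + 2 + 8) 5) /osum.
rewrite (@mul_row_block _ 1 (2 + 2 + 8) 5 (2 + 2 + 8) 5).
rewrite !mulmx0 addr0 add0r -/cl mul_mx_scalar scaleN1r -/z.
rewrite /A1_vec scale_row_mx add_row_mx addr0 -scalemxAr; congr row_mx.
apply/rowP => i; rewrite !mxE [LHS](divz_eq _ 2) mulrC; congr (_ + _).
move: (- c _ _) => a; have : 0 <= (a %% 2)%Z < 2 by rewrite modz_ge0 ?ltz_pmod.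
by case: (a %% 2)%Z => [[|[|]]|].
Qed.

(** For fixed j, its half represents the isotropic class of A_T that is the sum
    of all xi_i with i <> j. *)
Definition div2_vec (j : 'I_5) : 'rV[int]_T_rank :=
  2 *: (U1_vec 0 + U1_vec 1) + A1_vec (ones (fun i => i != j)).

(** With |s| the number of r_i in the reduction of v modulo 2, (v, v) = 0 reads
    2 |s| = 0 modulo 8, and |s| = 0 would make v twice a vector. *)
Lemma isotropic_mod2 v : primitive_isotropic T_lat v ->
  (forall x, (2 %| form T_lat v x)%Z) ->
  exists j y, v = 2 *: y + A1_vec (ones (fun i => i != j)).
Proof.
move=> /primitive_isotropic1P[v0 vv vsat] /even_divisor_mod2[s [y vE]].
have [q yy] := even_T_lat y.
have card4 : (4 %| #|s|%:R)%Z.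
  apply/dvdzP; exists (q - (A1_vec (ones s) *m y^T) 0 0).
  have := vv; rewrite vE !(formDl, formDr, formZl, formZr) yy.
  rewrite (formC T_lat_tr y) form_A1 form_A1_A1 ones_sqr.
  set t := (_ *m _) 0 0; lia.
have card5 : (#|s| <= 5)%N by have := max_card s; rewrite card_ord.
have card_s : #|s| = 4%N.
  have : #|s| <> 0%N.
    move=> s0; have sE i : s i = false.
      by apply/negbTE; have /eqP/pred0P := s0; move=> /(_ i) /= ->.
    have ones0 : A1_vec (ones s) = 0.
      rewrite /A1_vec (_ : ones s = 0) ?row_mx0 //.
      by apply/rowP => i; rewrite !mxE sE.
    rewrite ones0 addr0 in vE.
    have [||d yE] := vsat 2 1 y; rewrite ?scale1r //.
    move: vE; rewrite yE scalerA => /eqP; rewrite -subr_eq0 -{1}[v]scale1r.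
    by rewrite -scalerBl scalemx_eq0 (negPf v0) orbF => /eqP; lia.
  by lia.
have : #|[predC s]| = 1%N.
  by have := cardC s; rewrite card_ord card_s => /(@addnI 4 _ 1%N).
move=> /mem_card1[j sj]; exists j, y; rewrite vE; congr (_ + A1_vec _).
apply/rowP => i; rewrite !mxE; have := sj i; rewrite !inE => <-.
by rewrite negbK.
Qed.

(** * The groups *)

Lemma eq_disc_xi0 g : eq_disc (xi ord0 *m toQ g) (xi ord0) <->
  exists t, r ord0 *m g = r ord0 + 2 *: t.
Proof.
have half (x : 'rV[rat]_T_rank) : 2%:R *: (2%:R^-1 *: x) = x.
  by rewrite scalerA divff // scale1r.
rewrite /eq_disc /xi -scalemxAl -scalerBr -map_mxM -map_mxB; split=> -[t tE].
  exists t; apply/eqP; rewrite addrC -subr_eq; apply/eqP/(@intr_mx_inj rat).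
  by rewrite -[LHS]half tE map_mxZ.
by exists t; rewrite tE addrC addKr map_mxZ scalerA mulVf // scale1r.
Qed.

Lemma Gamma_starP g : Gamma_star g <->
  Gamma g /\ exists t, r ord0 *m g = r ord0 + 2 *: t.
Proof. by split=> -[gG /eq_disc_xi0]. Qed.

Definition isometry_group n (G : 'M[int]_n) (H : set 'M[int]_n) :=
  [/\ H `<=` isometries G, H 1%:M,
      forall g h, H g -> H h -> H (g *m h) & forall g, H g -> H (invmx g)].

Lemma isometries_group n (G : 'M[int]_n) : isometry_group G (isometries G).
Proof.
split=> //.
- by split; rewrite ?unitmx1 // mul1mx trmx1 mulmx1.
- move=> g h [gu gG] [hu hG]; split; first by rewrite unitmx_mul gu.
  by rewrite trmx_mul !mulmxA -(mulmxA g) -(mulmxA g) hG.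
- move=> g [gu gG]; split; first by rewrite unitmx_inv.
  by rewrite -{1}gG !mulmxA mulVmx // mul1mx -mulmxA -trmx_mul mulVmx ?trmx1
    ?mulmx1.
Qed.

Lemma Gamma_star_group : isometry_group T_lat Gamma_star.
Proof.
have [_ G1 GM GV] := isometries_group T_lat.
split=> [g []// ||g h|g]; rewrite !Gamma_starP.
- by split=> //; exists 0; rewrite mulmx1 scaler0 addr0.
- move=> [gG [s gE]] [hG [t hE]]; split; first exact: GM.
  exists (t + s *m h); rewrite mulmxA gE mulmxDl hE -scalemxAl.
  by rewrite scalerDr addrA.
- move=> [gG [s gE]]; split; first exact: GV.
  have gu := gG.1; exists (- (s *m invmx g)).
  rewrite -{2}(mulmxK gu (r ord0)) gE mulmxDl -scalemxAl scalerN.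
  by rewrite addrK.
Qed.

Lemma Gamma_starN1 : Gamma_star (- 1%:M).
Proof.
apply/Gamma_starP; split.
  apply: (form_isometries T_lat_det) => x y.
  by rewrite !mulmxN !mulmx1 formNl formNr opprK.
exists (- r ord0); rewrite mulmxN mulmx1.
by apply/rowP => i; rewrite !mxE; ring.
Qed.

(** Since (r_0, y) is even for all y, t(e, x) moves r_0 by an element of 2 T. *)
Lemma Gamma_star_eichler e x (q : int) : form T_lat e e = 0 ->
  form T_lat e x = 0 -> form T_lat x x = 2 * q ->
  Gamma_star (eichler T_lat e x q).
Proof.
move=> ee ex xx; apply/Gamma_starP; split.
  exact: (eichler_isometry T_lat_det T_lat_tr).
rewrite mul_eichler r_A1 !form_A1.
set b := (_ *m x^T) 0 0; set c := (_ *m e^T) 0 0.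
exists (b *: e - c *: x + (q * c) *: e).
by apply/rowP => i; rewrite !mxE; ring.
Qed.

(** * Orbits of primitive isotropic vectors *)

Lemma form_div2_U1 j : form T_lat (div2_vec j) (U1_vec 0) = 2.
Proof. by rewrite formDl formZl formDl !form_U1 form_A1_U1 !mxE. Qed.

Lemma form_div2_A1 j z : form T_lat (div2_vec j) (A1_vec z) =
  -2 * (ones (fun i => i != j) *m z^T) 0 0.
Proof.
rewrite formDl formZl formDl !(formC T_lat_tr (U1_vec _)) !form_A1_U1.
by rewrite form_A1_A1 addr0 mulr0 add0r.
Qed.

Lemma card_neq (j : 'I_5) : #|(fun i => i != j) : pred 'I_5| = 4%N.
Proof. by rewrite (@eq_card _ _ (predC1 j)) // cardC1 card_ord. Qed.

Lemma div2_vec_isotropic j : form T_lat (div2_vec j) (div2_vec j) = 0.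
Proof.
rewrite {2}/div2_vec formDr formZr formDr form_div2_U1 form_div2_A1 ones_sqr.
by rewrite card_neq formDl formZl formDl !form_U1 form_A1_U1 !mxE.
Qed.

Lemma div2_vec_even j x : (2 %| form T_lat (div2_vec j) x)%Z.
Proof.
by rewrite formDl formZl form_A1 mulNr -mulrN -mulrDr; exact: dvdz_mulr.
Qed.

Lemma div2_vec_coord j i : div2_vec j 0 (rshift (2 + 2 + 8) i) = (i != j)%:R.
Proof.
rewrite /div2_vec mxE A1_vecr !mxE !eq_rlshift !andbF.
by rewrite addr0 mulr0 add0r.
Qed.

Lemma div2_vec_primitive j : primitive_isotropic T_lat (div2_vec j).
Proof.
have [i ij] : exists i, i != j.
  exists (if j == 0 then 1 else 0).
  by case: (eqVneq j 0) => [->|]; rewrite // eq_sym.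
apply: (@primitive_isotropic_unit _ _ _ (rshift (2 + 2 + 8) i)).
  exact: div2_vec_isotropic.
by rewrite div2_vec_coord ij.
Qed.

Lemma U1_primitive : primitive_isotropic T_lat (U1_vec 1).
Proof.
apply: (@primitive_isotropic_unit _ _ _ (lshift 5 (lshift 8 (lshift 2 1)))).
  by rewrite form_U1 mxE.
by rewrite mxE !eqxx.
Qed.

Lemma Gamma_star_orbits B : primitive_isotropic T_lat B ->
  orbit_rel Gamma_star B (U1_vec 1) \/
  exists j, orbit_rel Gamma_star B (div2_vec j).
Proof.
have [Gsub G1 GM _] := Gamma_star_group.
move=> Bprim; have /primitive_isotropic1P[B0 BB _] := Bprim.
have [w [m [Bw m0 wu0 wdiv]]] := orbit_divisor T_lat_tr T_lat_det T_lat_even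
  G1 Gamma_starN1 GM Gamma_star_eichler B0 U1_hyperbolic U2_hyperbolic
  U1_U2_orthogonal.
have [wprim ww] : primitive_isotropic T_lat w /\ form T_lat w w = 0.
  have [g gG ->] := Bw; rewrite isometry_form; last exact: Gsub.
  by split=> //; apply: primitive_isotropic_act => //; exact: Gsub.
have criterion := eichler_criterion T_lat_tr T_lat_even Gamma_star_eichler.
have uu i : form T_lat (U1_vec i) (U1_vec i) = 0 by rewrite form_U1 mxE eqxx.
have trans := orbit_rel_trans GM Bw.
have [m1|m2] := divisor_eq1_or_2 wprim m0 wdiv.
  left; apply: trans; rewrite m1 in wu0.
  apply: (@criterion w (U1_vec 1) (U1_vec 0) (U1_vec 1 - w) 1) => //.
    by rewrite form_U1 mxE.
  by rewrite scale1r addrC subrK.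
right; rewrite {}m2 in wu0 wdiv; have [j [y wE]] := isotropic_mod2 wprim wdiv.
exists j; apply: trans.
apply: (@criterion w (div2_vec j) (U1_vec 0) (U1_vec 0 + U1_vec 1 - y) 2) => //.
- exact: form_div2_U1.
- exact: div2_vec_isotropic.
- by rewrite wE /div2_vec scalerBr; apply/rowP => k; rewrite !mxE; ring.
Qed.

(** For a = A1_vec z one has a G = -2 a and (a, a) = -4, so this is the
    reflection v |-> v - 2 (v, a) / (a, a) a, which is integral on T. *)
Lemma A1_reflection (z : 'rV[int]_5) : z *m z^T = 2%:M ->
  Gamma (1%:M - (A1_vec z)^T *m A1_vec z).
Proof.
move=> zz; apply: (form_isometries T_lat_det) => x y.
have actE v : v *m (1%:M - (A1_vec z)^T *m A1_vec z) =
    v - (v *m (A1_vec z)^T) 0 0 *: A1_vec z.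
  by rewrite -mul_scalar_mx -mx11_scalar -mulmxA mulmxBr mulmx1.
have form_a1r v : form T_lat v (A1_vec z) = -2 * (v *m (A1_vec z)^T) 0 0.
  by rewrite (formC T_lat_tr) form_A1 -[in RHS](trmxK v) -trmx_mul [in RHS]mxE.
have a1z : form T_lat (A1_vec z) (A1_vec z) = -4 by rewrite form_A1_A1 zz mxE.
rewrite !actE !(formDl, formDr, formNl, formNr, formZl, formZr).
by rewrite a1z (formC T_lat_tr (A1_vec z)) !form_a1r; ring.
Qed.

Lemma mul_A1_reflection (y : 'rV[int]_(2 + 2 + 8)) (x z : 'rV[int]_5) :
  row_mx y x *m (1%:M - (A1_vec z)^T *m A1_vec z) =
  row_mx y (x - (x *m z^T) 0 0 *: z) :> 'rV_T_rank.
Proof.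
rewrite mulmxBr mulmx1 mulmxA /A1_vec (@tr_row_mx _ 1 (2 + 2 + 8) 5).
rewrite (@mul_row_col _ 1 (2 + 2 + 8) 5 1).
rewrite trmx0 mulmx0 add0r [x *m z^T in LHS]mx11_scalar mul_scalar_mx.
by rewrite scale_row_mx scaler0 opp_row_mx add_row_mx oppr0 addr0.
Qed.

(** The reflection in r_i - r_j, exchanging r_i and r_j. *)
Definition swap_mx (i j : 'I_5) : 'M[int]_T_rank :=
  let a := A1_vec (delta_mx 0 i - delta_mx 0 j) in 1%:M - a^T *m a.

Lemma delta_dot (x : 'rV[int]_5) i :
  (x *m (delta_mx 0 i : 'rV_5)^T) 0 0 = x 0 i.
Proof. by rewrite trmx_delta -colE mxE. Qed.

Lemma swap_dot (x : 'rV[int]_5) i j :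
  (x *m (delta_mx 0 i - delta_mx 0 j : 'rV_5)^T) 0 0 = x 0 i - x 0 j.
Proof. by rewrite linearB /= mulmxBr [LHS]mxE [X in _ + X]mxE !delta_dot. Qed.

Lemma swap_isometry i j : i != j -> Gamma (swap_mx i j).
Proof.
move=> ij; apply: A1_reflection; rewrite [LHS]mx11_scalar; congr (_%:M).
rewrite swap_dot !mxE !eqxx.
by rewrite (negPf ij) eq_sym (negPf ij).
Qed.

Lemma div2_vec_swap i j : i != j -> div2_vec i *m swap_mx i j = div2_vec j.
Proof.
move=> ij.
have VE k : div2_vec k = row_mx (2 *: (delta_mx 0 (lshift 8 (lshift 2 0))
    + delta_mx 0 (lshift 8 (lshift 2 1)))) (ones (fun i => i != k)).
  apply/rowP => h; case: (split_ordP h) => l ->.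
    by rewrite [RHS]row_mxEl mxE A1_vecl !mxE !eq_lshift addr0.
  by rewrite [RHS]row_mxEr div2_vec_coord mxE.
rewrite !VE mul_A1_reflection; congr row_mx.
rewrite swap_dot !mxE eqxx.
apply/rowP => k; rewrite !mxE (eq_sym j) ij.
have [->|ki] := eqVneq k i; first by rewrite (negPf ij).
by case: (k == j).
Qed.

Lemma swap_Gamma_star i j : i != j -> ord0 != i -> ord0 != j ->
  Gamma_star (swap_mx i j).
Proof.
move=> ij i0 j0; apply/Gamma_starP; split; first exact: swap_isometry.
exists 0; rewrite scaler0 addr0 r_A1 {1}/A1_vec mul_A1_reflection.
rewrite swap_dot !mxE.
by rewrite !(eq_sym _ ord0) (negPf i0) (negPf j0) subrr scale0r subr0.
Qed.

Lemma Gamma_star_orbits3 B : primitive_isotropic T_lat B ->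
  [\/ orbit_rel Gamma_star B (U1_vec 1), orbit_rel Gamma_star B (div2_vec 1) |
      orbit_rel Gamma_star B (div2_vec 0)].
Proof.
have [_ _ GM _] := Gamma_star_group.
case/Gamma_star_orbits => [|[j b]]; first by constructor 1.
have [<-|j0] := eqVneq j 0; first by constructor 3.
have [<-|j1] := eqVneq j 1; first by constructor 2.
constructor 2; apply: (orbit_rel_trans GM b).
exists (swap_mx j 1); last by rewrite div2_vec_swap.
by apply: swap_Gamma_star; rewrite // eq_sym.
Qed.

Lemma Gamma_orbits2 B : primitive_isotropic T_lat B ->
  orbit_rel Gamma B (U1_vec 1) \/ orbit_rel Gamma B (div2_vec 1).
Proof.
have [_ _ GM _] := isometries_group T_lat.
have sub v w : orbit_rel Gamma_star v w -> orbit_rel Gamma v w.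
  by move=> [g [gG _] ->]; exists g.
case/Gamma_star_orbits3 => /sub; [by left | by right |].
move=> BV; right; apply: (orbit_rel_trans (H := Gamma) GM BV).
by exists (swap_mx 0 1); [exact: swap_isometry | rewrite div2_vec_swap].
Qed.

Definition line_equiv n (H : set 'M[int]_n) (v w : 'rV[int]_n) :=
  exists2 g, H g & w = v *m g \/ w = - (v *m g).

Lemma even_divisor_equiv v w : line_equiv Gamma v w ->
  (forall x, (2 %| form T_lat w x)%Z) -> forall x, (2 %| form T_lat v x)%Z.
Proof.
move=> [g gG wE] w2 x; rewrite -(isometry_form v x gG).
have := w2 (x *m g); case: wE => ->; rewrite ?formNl //.
by rewrite dvdzE abszN -dvdzE.
Qed.

Lemma U1_div2_vec_inequiv j : ~ line_equiv Gamma (U1_vec 1) (div2_vec j).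
Proof.
move=> /even_divisor_equiv/(_ (div2_vec_even j) (U1_vec 0)).
by rewrite form_U1 mxE.
Qed.

(** Write r_0 g = r_0 + 2 t: then (v, r_0) = (v g, r_0) + 2 (v g, t), and
    (v g, t) is even. *)
Lemma form_r0_mod4 v g : Gamma_star g -> (forall x, (2 %| form T_lat v x)%Z) ->
  (form T_lat (v *m g) (r ord0) = form T_lat v (r ord0) %[mod 4])%Z.
Proof.
move=> /Gamma_starP[gG [t rg]] v2.
rewrite -(isometry_form v (r ord0) gG) rg formDr formZr.
have /dvdzP[k ->] : (2 %| form T_lat (v *m g) t)%Z.
  rewrite -(mulmxKV gG.1 t) isometry_form //; exact: v2.
rewrite (_ : _ + _ = k * 4 + form T_lat (v *m g) (r ord0)); last by ring.
by rewrite modzMDl.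
Qed.

Lemma div2_vec_inequiv : ~ line_equiv Gamma_star (div2_vec 1) (div2_vec 0).
Proof.
move=> [g gG VE]; have := form_r0_mod4 gG (div2_vec_even 1).
have rV j : form T_lat (div2_vec j) (r ord0) = -2 * (ord0 != j)%:R.
  by rewrite r_A1 form_div2_A1 delta_dot mxE.
have -> : form T_lat (div2_vec 1 *m g) (r ord0) = 0.
  have := rV 0; rewrite eqxx mulr0; case: VE => -> //.
  by rewrite formNl => /eqP; rewrite oppr_eq0 => /eqP.
by rewrite rV.
Qed.

(** * Zero-dimensional boundary components *)

Section Boundary.
Variables (R : realType) (n : nat) (G : 'M[int]_n).
Local Notation VC := ('rV[R[i]]_n).
Local Notation toC := (map_mx (intr : int -> R[i])).
Implicit Types (B : 'rV[int]_n) (g : 'M[int]_n) (p : set VC).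

Lemma proj_ptZ c (w : VC) : c != 0 -> proj_pt (c *: w) = proj_pt w.
Proof.
move=> c0; apply/seteqP; split=> x [d d0 <-].
  by exists (d * c); rewrite ?scalerA //; exact: mulf_neq0.
exists (d / c); last by rewrite scalerA divfK.
by apply: mulf_neq0 => //; rewrite invr_neq0.
Qed.

Lemma proj_ptN (w : VC) : proj_pt (- w) = proj_pt w.
Proof. by rewrite -scaleN1r proj_ptZ // oppr_eq0 oner_eq0. Qed.

Lemma proj_pt_refl (w : VC) : proj_pt w w.
Proof. by exists 1; rewrite ?scale1r //= oner_eq0. Qed.

Lemma act_proj_pt g (w : VC) : act_pt g (proj_pt w) = proj_pt (w *m toC g).
Proof.
apply/seteqP; split=> x.
  by move=> [_ [c c0 <-] <-]; exists c => //; rewrite scalemxAl.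
by move=> [c c0 <-]; exists (c *: w); [exists c | rewrite scalemxAl].
Qed.

Lemma act_ptM g h p : act_pt h (act_pt g p) = act_pt (g *m h) p.
Proof.
rewrite /act_pt image_comp; apply: eq_imagel => x _ /=.
by rewrite map_mxM mulmxA.
Qed.

Lemma act_pt1 p : act_pt 1%:M p = p.
Proof.
rewrite /act_pt map_mx1; apply/seteqP; split=> x.
  by move=> [y py <-]; rewrite mulmx1.
by move=> px; exists x; rewrite ?mulmx1.
Qed.

Lemma rat_bcomp1 B : B != 0 -> rat_bcomp (R := R) B = [set proj_pt (toC B)].
Proof.
move=> B0; have C0 : toC B != 0.
  apply: contra_neq B0 => B0.
  by apply: (@intr_mx_inj R[i] 1 n); rewrite B0 map_mx0.
apply/seteqP; split=> p /=.
  move=> [w /= wB <-].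
  have /sub_rVP[c wE] : (w <= toC B)%MS.
    by rewrite -(eqmxP wB) -addsmxE addsmxSl.
  have c0 : c != 0.
    apply: contra_neq C0 => c0; move: wB; rewrite wE c0 scale0r map_mx0.
    by rewrite col_mx0 => /andP[_ /submx0null].
  by rewrite wE proj_ptZ.
move=> ->; exists (toC B) => //=.
have -> : map_mx Num.conj (toC B) = toC B.
  by apply/rowP => j; rewrite !mxE rmorph_int.
by rewrite col_mx_sub submx_refl /= -addsmxE addsmxSl.
Qed.

Variable H : set 'M[int]_n.
Hypothesis Hgroup : isometry_group G H.

Lemma quot_pt_act g p : H g -> quot_pt H (act_pt g p) = quot_pt H p.
Proof.
have [Hsub _ HM HV] := Hgroup => gH; apply/seteqP; split=> _ [h hH <-].
  by exists (g *m h); [exact: HM | rewrite act_ptM].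
exists (invmx g *m h); first by apply: HM => //; exact: HV.
by rewrite act_ptM mulmxA mulmxV ?mul1mx //; have [] := Hsub _ gH.
Qed.

Lemma quot_pt_refl p : quot_pt H p p.
Proof. by have [_ H1 _ _] := Hgroup; exists 1%:M; rewrite ?act_pt1. Qed.

Definition cusp B : set (set (set VC)) := quot_pt H @` rat_bcomp B.

Lemma cuspE B : B != 0 -> cusp B = [set quot_pt H (proj_pt (toC B))].
Proof. by move=> B0; rewrite /cusp rat_bcomp1 // image_set1. Qed.

(** If a cusp were the image of a point [w] of the domain, w would be
    proportional to an integral isotropic vector, whose complex conjugate is
    itself, against (w, conj w) > 0. *)
Lemma cusp_boundary B : primitive_isotropic G B ->
  cusp B `<=` SBB_boundary (R := R) G H.
Proof.
move=> Bprim; have [Hsub _ _ _] := Hgroup.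
have /primitive_isotropic1P[B0 BB _] := Bprim.
rewrite cuspE // => _ ->; split.
  exists (proj_pt (toC B)) => //; right; exists 0%N, B; split => //.
  by rewrite rat_bcomp1.
move=> [_ [w [w0 ww wpos] <-] wE].
have : quot_pt H (proj_pt w) (proj_pt (toC B)).
  by rewrite wE; exact: quot_pt_refl.
move=> [g gH]; rewrite act_proj_pt => gE.
have : proj_pt (toC B) (w *m toC g) by rewrite -gE; exact: proj_pt_refl.
move=> [c c0 cE]; move: wpos.
have -> : w = c *: toC (B *m invmx g).
  have [gu _] := Hsub _ gH.
  rewrite map_mxM scalemxAl cE -mulmxA -map_mxM mulmxV // map_mx1 mulmx1.
  by [].
have -> : map_mx Num.conj (c *: toC (B *m invmx g)) =
    Num.conj c *: toC (B *m invmx g).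
  by apply/rowP => j; rewrite !mxE rmorphM rmorph_int.
rewrite formZl formZr.
have -> : form G (toC (B *m invmx g)) (toC (B *m invmx g)) = (0 : R[i]).
  rewrite map_mxM form_isometry; last first.
    by have [_ _ _ HV] := Hgroup; exact/Hsub/HV.
  rewrite /form matrix.map_trmx -!map_mxM mxE.
  by move: BB; rewrite formE => ->.
by rewrite !mulr0 ltxx.
Qed.

(** On a nonzero coordinate of B the relation reads B'_j = c B_j, so an integral
    multiple of B' is an integral multiple of B, and B is primitive. *)
Lemma primitive_multiple B B' (c : R[i]) :
  primitive_isotropic G B -> toC B' = c *: toC B -> exists d : int, c = d%:~R.
Proof.
move=> /primitive_isotropic1P[B0 _ Bsat] cE.
have /rV0Pn[j Bj] := B0.
have cj : (B' 0 j)%:~R = c * (B 0 j)%:~R :> R[i].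
  by have := congr1 (fun M : VC => M 0 j) cE; rewrite !mxE.
have [|d dE] := Bsat (B 0 j) (B' 0 j) B' Bj.
  by apply: (@intr_mx_inj R[i] 1 n); rewrite !map_mxZ cE scalerA mulrC -cj.
exists d; apply: (mulIf (x := (B 0 j)%:~R)); first by rewrite intr_eq0.
by rewrite -cj dE mxE intrM.
Qed.

Lemma cusp_equiv B B' : primitive_isotropic G B -> primitive_isotropic G B' ->
  cusp B = cusp B' <-> line_equiv H B B'.
Proof.
move=> Bprim B'prim; have [Hsub _ _ _] := Hgroup.
have /primitive_isotropic1P[B0 _ _] := Bprim.
have /primitive_isotropic1P[B'0 _ _] := B'prim.
rewrite !cuspE //; split=> [E|[g gH gE]]; last first.
  congr [set _]; rewrite -(quot_pt_act _ gH) act_proj_pt -map_mxM.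
  by case: gE => ->; rewrite // map_mxN proj_ptN.
have : quot_pt H (proj_pt (toC B)) (proj_pt (toC B')).
  have -> : quot_pt H (proj_pt (toC B)) = quot_pt H (proj_pt (toC B')).
    by have : [set quot_pt H (proj_pt (toC B'))]
      (quot_pt H (proj_pt (toC B))) by rewrite -E.
  exact: quot_pt_refl.
move=> [g gH]; rewrite act_proj_pt -map_mxM => gE; exists g => //.
have Bgprim := primitive_isotropic_act (Hsub _ gH) Bprim.
have : proj_pt (toC (B *m g)) (toC B') by rewrite gE; exact: proj_pt_refl.
move=> [c c0 cE].
have [d dE] := primitive_multiple Bgprim (esym cE).
have [|d' d'E] := @primitive_multiple B' (B *m g) c^-1 B'prim.
  by rewrite -cE scalerA mulVf // scale1r.
have dd : d * d' = 1.
  by apply/eqP; rewrite -(eqr_int R[i]) intrM -dE -d'E divff.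
have B'E : B' = d *: (B *m g).
  by apply: (@intr_mx_inj R[i] 1 n); rewrite -cE dE map_mxZ.
have : (d == 1) || (d == -1).
  by have : d \is a GRing.unit by apply/unitrPr; exists d'.
by case/orP => /eqP d1; [left|right]; rewrite B'E d1 ?scale1r ?scaleN1r.
Qed.

Lemma boundary_components_card (m : nat) (rep : nat -> 'rV[int]_n) :
  (forall k, primitive_isotropic G (rep k)) ->
  (forall B, primitive_isotropic G B ->
     exists2 k, (k < m)%N & line_equiv H B (rep k)) ->
  (forall j k, (j < k)%N -> (k < m)%N -> ~ line_equiv H (rep j) (rep k)) ->
  boundary_components R G H 0 #= `I_m.
Proof.
move=> prim surj inj.
have -> : boundary_components R G H 0 = (cusp \o rep) @` `I_m.
  apply/seteqP; split=> X.
    move=> [_ [B Bprim ->]]; have [k km Bk] := surj B Bprim.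
    exists k => //=; symmetry; exact/(cusp_equiv Bprim (prim k)).
  move=> [k km <-]; split; first exact: cusp_boundary.
  by exists (rep k).
apply: inj_card_eq => j k; rewrite !inE /= => jm km E.
have [jk|kj|//] := ltngtP j k.
  by case: (inj j k jk km); apply/(cusp_equiv (prim j) (prim k)).
by case: (inj k j kj jm); apply/(cusp_equiv (prim k) (prim j)).
Qed.

End Boundary.

(** The default value of [nth] is the third representative, so that the same
    enumeration serves both groups. *)
Definition isotropic_rep k := nth (div2_vec 0) [:: U1_vec 1; div2_vec 1] k.

Lemma isotropic_rep_primitive k : primitive_isotropic T_lat (isotropic_rep k).
Proof.
case: k => [|[|k]]; rewrite /isotropic_rep /= ?nth_nil;
  [exact: U1_primitive | exact: div2_vec_primitive | exact: div2_vec_primitive].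
Qed.

Lemma orbit_line n (H : set 'M[int]_n) v w :
  orbit_rel H v w -> line_equiv H v w.
Proof. by move=> [g gH wE]; exists g => //; left. Qed.

Theorem corollary5 (R : realType) :
  boundary_components R T_lat Gamma 0 #= `I_2 /\
  boundary_components R T_lat Gamma_star 0 #= `I_3.
Proof.
split; apply: (@boundary_components_card _ _ _ _ _ _ isotropic_rep).
- exact: isometries_group.
- exact: isotropic_rep_primitive.
- move=> B /Gamma_orbits2[] /orbit_line Bk; [by exists 0%N | by exists 1%N].
- by move=> [|[|j]] [|[|k]] // _ _; exact: U1_div2_vec_inequiv.
- exact: Gamma_star_group.
- exact: isotropic_rep_primitive.
- move=> B /Gamma_star_orbits3[] /orbit_line Bk;
    [by exists 0%N | by exists 1%N | by exists 2%N].
- have sub v w : line_equiv Gamma_star v w -> line_equiv Gamma v w.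
    by move=> [g [gG _] wE]; exists g.
  move=> [|[|[|j]]] [|[|[|k]]] // _ _;
    [by move=> /sub; exact: U1_div2_vec_inequiv .. | exact: div2_vec_inequiv].
Qed.
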